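(* Consider an M/G/1 queue with Poisson arrivals of rate $\lambda>0$ and i.i.d. service times distributed as $S$, where $S$ has a density with Laplace transform $\varphi$. Let $W+1$ be the number of customers served in a busy period (started by a single customer arriving to an empty system). Let $p=\mathbb{E}e^{-\lambda S}$, let $\xi$ be the real solution of $1+\lambda\varphi'(s)=0$ nearest the origin, and let $$\theta=\frac{\xi-\lambda+\lambda\varphi(\xi)}{(\xi-\lambda)\varphi(\lambda)}.$$ Suppose that $S$ is IFR and that $\rho=\lambda\mathbb{E}S<1$. Let $N\sim\mathrm{Geom}(p)$ and $Y=\sum_{i=1}^N X_i$, where $X,X_1,X_2,\ldots$ are i.i.d. positive, integer-valued random variables independent of $N$ with $(1-p)\theta\,\mathbb{E}X\geq1-p\theta$. Then $$d_{TV}(\mathcal{L}(W),\mathcal{L}(Y))\leq H_p(X)\left(\frac{(1-p)\mathbb{E}X}{p}-\frac{\rho}{1-\rho}\right).$$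
   Context: A continuous nonnegative random variable $S$ with density $f$ is IFR if its failure rate $f(t)/\mathbb{P}(S>t)$ is nondecreasing in $t$. $N\sim\mathrm{Geom}(p)$ means $\mathbb{P}(N=k)=p(1-p)^k$, $k\ge0$; the empty sum is $0$. $d_{TV}(\mathcal{L}(U),\mathcal{L}(V))=\sup_{A\subseteq\{0,1,2,\ldots\}}|\mathbb{P}(U\in A)-\mathbb{P}(V\in A)|$. For $0\le p\le1$ and positive integer-valued $X$, with $u=1-d_{TV}(\mathcal{L}(X),\mathcal{L}(X+1))$, $H_p(X)=\min\{p+(1-p)\mathbb{P}(X>1),\ p(1+\sqrt{-2/(u\log(1-p))})\}$. *)

(* Defs.v *)
From HB Require Import structures.
From mathcomp Require Import all_boot all_order all_algebra.
From mathcomp Require Import all_classical all_reals all_analysis.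
Set Implicit Arguments. Unset Strict Implicit. Unset Printing Implicit Defensive.
Import Order.TTheory GRing.Theory Num.Theory.
Import numFieldNormedType.Exports.
Local Open Scope classical_set_scope.
Local Open Scope ring_scope.

Section Defs.
Variable R : realType.
Local Notation mu := (@lebesgue_measure R).

(* ---------- the service time S, given by a density f on R (f = 0 on ]-oo,0[) ---------- *)

Definition surv (f : R -> R) (t : R) : R :=
  fine (\int[mu]_(x in `]t, +oo[) (f x)%:E)%E.

(* S is IFR: the failure rate f(t)/P(S>t) is nondecreasing in t
   (where it is defined, i.e. where P(S>t) > 0). *)
Definition IFR (f : R -> R) : Prop :=
  forall s t : R, s <= t -> 0 < surv f t -> f s / surv f s <= f t / surv f t.

Definition ES (f : R -> R) : \bar R := (\int[mu]_(x in setT) (x * f x)%:E)%E.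

(* Laplace transform phi(s) = E e^{-sS} (extended real; may be +oo for s < 0) *)
Definition laplaceE (f : R -> R) (s : R) : \bar R :=
  (\int[mu]_(x in setT) (expR (- (s * x)) * f x)%:E)%E.

Definition laplace (f : R -> R) (s : R) : R := fine (laplaceE f s).

Definition laplace_root (f : R -> R) (lam s : R) : Prop :=
  (exists2 e : R, 0 < e & forall r : R, `|r - s| < e -> (laplaceE f r < +oo)%E)
  /\ derivable (laplace f) s 1
  /\ 1 + lam * derive1 (laplace f) s = 0.

Definition nearest_laplace_root (f : R -> R) (lam xi : R) : Prop :=
  laplace_root f lam xi /\ (forall s : R, laplace_root f lam s -> `|xi| <= `|s|).

(* law of the number of Poisson(lam) arrivals during one service:
   a_k = E[ e^{-lam S} (lam S)^k / k! ] *)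
Definition arrivals_pmf (f : R -> R) (lam : R) (k : nat) : R :=
  fine (\int[mu]_(x in setT)
          (f x * expR (- (lam * x)) * (lam * x) ^+ k / (k`!)%:R)%:E)%E.

(* P(number served in the busy period = n), n >= 1.  With A_1, A_2, ... i.i.d.
   arrivals during successive services, the number left after the j-th departure
   is 1 + sum_{i<=j} (A_i - 1) and the busy period ends at the first j where it is
   0.  Every A_i with i <= n is then <= n-1, so sequences range over 'I_n. *)
Definition served_pmf (a : nat -> R) (n : nat) : R :=
  \sum_(s : {ffun 'I_n -> 'I_n} |
          ((\sum_(i < n) (s i : nat))%N == n.-1)
          && [forall j : 'I_n, (j <= \sum_(i < n | (i < j)%N) (s i : nat))%N])
     \prod_(i < n) a (s i).

Definition W_pmf (f : R -> R) (lam : R) (m : nat) : R :=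
  served_pmf (arrivals_pmf f lam) m.+1.

Definition prob_in (u : nat -> R) (A : set nat) : R :=
  fine (\sum_(k <oo | k \in A) (u k)%:E)%E.

Definition dTV (u v : nat -> R) : R :=
  sup [set r : R | exists A : set nat, r = `|prob_in u A - prob_in v A|].

Definition mean (u : nat -> R) : \bar R := (\sum_(k <oo) (k%:R * u k)%:E)%E.

Definition shift_pmf (u : nat -> R) (n : nat) : R :=
  if n is m.+1 then u m else 0.

Definition conv (u v : nat -> R) (n : nat) : R :=
  \sum_(i < n.+1) u i * v (n - i)%N.

Fixpoint convpow (u : nat -> R) (k : nat) : nat -> R :=
  match k with
  | 0 => fun n => if n == 0%N then 1 else 0
  | k'.+1 => conv (convpow u k') u
  end.

Definition compound_geom_pmf (p : R) (u : nat -> R) (n : nat) : R :=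
  fine (\sum_(k <oo) (p * (1 - p) ^+ k * convpow u k n)%:E)%E.

(* H_p(X).  When u = 0 the second term of the min is +oo (division by 0 in the
   paper), so H_p(X) is then the first term. *)
Definition Hp (p : R) (q : nat -> R) : R :=
  let u := 1 - dTV q (shift_pmf q) in
  let t1 := p + (1 - p) * prob_in q [set k | (1 < k)%N] in
  if u == 0 then t1
  else Num.min t1 (p * (1 + Num.sqrt (- 2 / (u * ln (1 - p))))).

End Defs.

(* Main.v *)
Require Import Defs.
From HB Require Import structures.
From mathcomp Require Import all_boot all_order all_algebra.
From mathcomp Require Import all_classical all_reals all_analysis.
From mathcomp Require Import zify ring lra.
From mathcomp Require Import measurable_realfun.
Import Order.TTheory GRing.Theory Num.Theory.
Import numFieldNormedType.Exports.
Local Open Scope classical_set_scope.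
Local Open Scope ring_scope.

(* [W] and [Y] have the same atom [p] at 0, so their total variation distance is
   at most [1 - p]; also [H_p(X) >= p].  It therefore suffices that
   [(1 - p) EX / p - rho / (1 - rho) >= (1 - p) / p].  Convexity of [phi] makes its
   tangent at [xi] pass below [phi(0) = 1], so [r = 1 - p theta = lam phi(xi) / (lam - xi)]
   lies in [0, 1], and the hypothesis on [EX] says [(1 - p) EX / p >= r / (1 - r)].
   Jensen's inequality [phi(s) >= exp(- s ES)] at [s = xi] gives
   [r >= rho exp(1 - rho) >= rho (2 - rho)], so [r / (1 - r) >= 2 rho / (1 - rho)], and
   at [s = lam] it gives [p >= 1 - rho], so [(1 - p) / p <= rho / (1 - rho)]. *)

(** * Sub-probabilities on the naturals and total variation *)

Section SubProbability.
Context {R : realType}.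
Implicit Types (u v : nat -> R) (A : set nat).

(** Mass at most 1 suffices for the total variation bound, so the argument does not rest on the busy
    period ending almost surely. *)
Definition subprob u := (forall k, 0 <= u k) /\ (forall N, \sum_(0 <= k < N) u k <= 1).

Lemma nneseries_le_real {u : nat -> R} (P : pred nat) (c : R) :
  (forall k, 0 <= u k) -> (forall N, \sum_(0 <= k < N | P k) u k <= c) ->
  (\sum_(k <oo | P k) (u k)%:E <= c%:E)%E.
Proof.
move=> u0 uc; apply: lime_le.
  by apply: is_cvg_nneseries => n _ _; rewrite lee_fin.
by apply: nearW => n; rewrite sumEFin lee_fin.
Qed.

Lemma prob_in_ge0 {u} A : (forall k, 0 <= u k) -> 0 <= prob_in u A.
Proof. by move=> u0; apply/fine_ge0/nneseries_ge0 => n _ _; rewrite lee_fin. Qed.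

Lemma prob_in_le {u} A (c : R) : (forall k, 0 <= u k) ->
  (forall N, \sum_(0 <= k < N | k \in A) u k <= c) -> prob_in u A <= c.
Proof.
move=> u0 uc; have := nneseries_le_real (fun k => k \in A) c u0 uc.
have : (0 <= \sum_(k <oo | k \in A) (u k)%:E)%E.
  by apply: nneseries_ge0 => n _ _; rewrite lee_fin.
by rewrite /prob_in; case: (limn _) => [r||] //=; rewrite !lee_fin.
Qed.

Lemma prob_in_le1 {u} A : subprob u -> prob_in u A <= 1.
Proof.
move=> [u0 u1]; apply: prob_in_le => // N; apply: le_trans (u1 N).
by rewrite big_mkcond ler_sum// => k _; case: ifP.
Qed.

Lemma prob_in_ge_head {u} A : subprob u -> 0%N \in A -> u 0%N <= prob_in u A.
Proof.
move=> su A0; have [u0 u1] := su; rewrite /prob_in.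
(* The upper bound excludes [+oo], which [fine] would send to 0. *)
have le1 : (\sum_(k <oo | k \in A) (u k)%:E <= 1%:E)%E.
  apply: nneseries_le_real => // N; apply: le_trans (u1 N).
  by rewrite big_mkcond ler_sum// => k _; case: ifP.
have ge1 : ((u 0%N)%:E <= \sum_(k <oo | k \in A) (u k)%:E)%E.
  rewrite nneseries_recl//; last by move=> k _; rewrite lee_fin.
  by rewrite leeDl// nneseries_ge0// => n _ _; rewrite lee_fin.
move: le1 ge1; case: (limn _) => [r||] //=; by rewrite !lee_fin.
Qed.

Lemma prob_in_le_tail {u} A : subprob u -> 0%N \notin A ->
  prob_in u A <= 1 - u 0%N.
Proof.
move=> [u0 u1] A0; apply: prob_in_le => // -[|N].
  by rewrite big_nil subr_ge0; have := u1 1%N; rewrite big_nat1.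
rewrite big_ltn_cond// (negbTE A0) lerBrDl; apply: le_trans (u1 N.+1).
rewrite (big_ltn (leq0n N : (0 < N.+1)%N)) lerD2l big_mkcond ler_sum// => k _; by case: ifP.
Qed.

(* The two laws share their atom at 0, so they can only disagree on the
   remaining mass. *)
Lemma dTV_le_tail {u v} : subprob u -> subprob v -> u 0%N = v 0%N ->
  dTV u v <= 1 - u 0%N.
Proof.
move=> su sv uv; rewrite /dTV; apply: ge_sup.
  by exists `|prob_in u set0 - prob_in v set0|, set0.
move=> _ [A ->]; rewrite ler_norml.
have [A0|A0] := boolP (0%N \in A).
  have := prob_in_ge_head A su A0; have := prob_in_ge_head A sv A0.
  by have := prob_in_le1 A su; have := prob_in_le1 A sv; lra.
have := prob_in_le_tail A su A0; have := prob_in_le_tail A sv A0.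
by have := prob_in_ge0 A su.1; have := prob_in_ge0 A sv.1; lra.
Qed.

End SubProbability.

(** * Emptying times of the queue and the law of [W] *)

Section FirstPassage.
Context {R : realType}.
Variable a : nat -> R.
Hypothesis sub_a : subprob a.

(* Probability that a queue of [c] customers empties exactly at the [n]-th
   departure, with fewer than [K] arrivals during each service. *)
Fixpoint emptying_pmf (K c n : nat) : R :=
  match n, c with
  | 0, _ => (c == 0)%:R
  | n'.+1, 0 => 0
  | n'.+1, c'.+1 => \sum_(k < K) a k * emptying_pmf K (c' + k) n'
  end.

Lemma emptying_pmf_ge0 K c n : 0 <= emptying_pmf K c n.
Proof.
elim: n c => [|n IH] [|c] //=.
by apply: sumr_ge0 => k _; rewrite mulr_ge0 ?sub_a.1.
Qed.

(** In [served_pmf] the cutoff on arrivals varies with the number served; monotonicity brings all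
    terms to one cutoff. *)
Lemma emptying_pmf_le K L c n : (K <= L)%N ->
  emptying_pmf K c n <= emptying_pmf L c n.
Proof.
move=> KL; elim: n c => [|n IH] [|c] //=.
rewrite -(big_mkord xpredT (fun k => a k * emptying_pmf K (c + k) n)).
rewrite -(big_mkord xpredT (fun k => a k * emptying_pmf L (c + k) n)).
rewrite (big_cat_nat (leq0n K) KL)/= -[leLHS]addr0 lerD//.
  by apply: ler_sum => k _; rewrite ler_wpM2l ?sub_a.1.
by apply: sumr_ge0 => k _; rewrite mulr_ge0 ?sub_a.1 ?emptying_pmf_ge0.
Qed.

(** Conditioning on the first service shifts time by one; averaging over [a] the inductive bound,
    available for every starting size, keeps it at most 1. *)
Lemma sum_emptying_pmf_le1 K c N : \sum_(n < N) emptying_pmf K c n <= 1.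
Proof.
elim: N c => [|N IH] c; first by rewrite big_ord0.
rewrite big_ord_recl; case: c => [|c] /=.
  by rewrite big1 ?addr0// => i _.
rewrite add0r exchange_big/=.
under eq_bigr do rewrite -mulr_sumr.
apply: (@le_trans _ _ (\sum_(k < K) a k)).
  by apply: ler_sum => k _; rewrite ler_piMr ?sub_a.1.
by rewrite -(big_mkord xpredT); exact: sub_a.2.
Qed.

(** Extends the path condition of [served_pmf] from 1 to [c] initial customers, as the induction
    requires. The strict inequality says that someone is still present after [j] departures. *)
Definition empties_at {n K} (c : nat) (s : {ffun 'I_n -> 'I_K}) : bool :=
  (c + (\sum_(i < n) (s i : nat))%N == n)%N &&
  [forall j : 'I_n, (j < c + \sum_(i < n | (i < j)%N) (s i : nat))%N].

Definition ffun_cons {n} {T : finType} (x : T * {ffun 'I_n -> T}) : {ffun 'I_n.+1 -> T} :=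
  [ffun i => if unlift ord0 i is Some j then x.2 j else x.1].

Lemma ffun_cons_bij n (T : finType) : bijective (@ffun_cons n T).
Proof.
exists (fun s : {ffun 'I_n.+1 -> T} => (s ord0, [ffun j => s (lift ord0 j)])).
- case=> x t /=; congr (_, _); first by rewrite ffunE unlift_none.
  by apply/ffunP => j; rewrite !ffunE liftK.
- move=> s; apply/ffunP => i; rewrite ffunE.
  by case: unliftP => [j|] -> /=; rewrite ?ffunE.
Qed.

(** One departure and [k] arrivals turn [c + 1] customers into [c + k], so each condition at [j + 1]
    becomes the one at [j]. *)
Lemma empties_at_cons n K c (k : 'I_K) (t : {ffun 'I_n -> 'I_K}) :
  empties_at c.+1 (ffun_cons (k, t)) = empties_at (c + k) t.
Proof.
have consS (i : 'I_n) : ffun_cons (k, t) (lift ord0 i) = t i.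
  by rewrite ffunE liftK.
have cons0 : ffun_cons (k, t) ord0 = k by rewrite ffunE unlift_none.
rewrite /empties_at big_ord_recl cons0.
under eq_bigr do rewrite consS.
rewrite addSn eqSS addnA; congr (_ && _).
have E (j : 'I_n) : (\sum_(i < n.+1 | (i < lift ord0 j)%N) (ffun_cons (k, t) i : nat))%N =
    (k + \sum_(i < n | (i < j)%N) (t i : nat))%N.
  rewrite big_mkcond big_ord_recl /= cons0; congr addn.
  rewrite [RHS]big_mkcond; apply: eq_bigr => i _; rewrite consS.
  by rewrite /bump !leq0n !add1n ltnS.
apply/forallP/forallP => H j.
  by have := H (lift ord0 j); rewrite E /= /bump leq0n add1n addSn ltnS addnA.
(* At [j = 0] the condition is just [0 < c + 1]. *)
case: (unliftP ord0 j) => [j'|] ->; last by [].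
by rewrite E /= /bump leq0n add1n addSn ltnS addnA.
Qed.

Lemma emptying_pmfE K n c :
  \sum_(s : {ffun 'I_n -> 'I_K} | empties_at c s) \prod_(i < n) a (s i) =
  emptying_pmf K c n.
Proof.
elim: n c => [|n IH] [|c] /=.
- rewrite (eq_bigl xpredT); last first.
    by move=> s; rewrite /empties_at big_ord0 /=; apply/forallP => -[].
  under eq_bigr do rewrite big_ord0.
  by rewrite sumr_const card_ffun !card_ord expn0.
- rewrite big_pred0// => s; rewrite /empties_at big_ord0 addn0.
(* With no initial customer the condition already fails at [j = 0]. *)
- rewrite big_pred0// => s; apply/negbTE/negP => /andP[_ /forallP/(_ ord0)].
  by rewrite big1.
- rewrite (reindex (@ffun_cons n 'I_K)); last exact/onW_bij/ffun_cons_bij.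
  rewrite (eq_bigl (fun x : 'I_K * {ffun 'I_n -> 'I_K} => empties_at (c + x.1) x.2)); last first.
    by case=> k t; rewrite empties_at_cons.
  transitivity (\sum_(k < K) \sum_(t : {ffun 'I_n -> 'I_K} | empties_at (c + k) t)
      \prod_(i < n.+1) a (ffun_cons (k, t) i)).
    by rewrite pair_big_dep/=; apply: eq_bigr => -[].
  apply: eq_bigr => k _; rewrite -IH mulr_sumr; apply: eq_bigr => t _.
  rewrite big_ord_recl ffunE unlift_none; congr (_ * _).
  by apply: eq_bigr => i _; rewrite ffunE liftK.
Qed.

Lemma served_pmfE n : served_pmf a n.+1 = emptying_pmf n.+1 1 n.+1.
Proof. by rewrite -emptying_pmfE; apply: eq_bigl => s; rewrite /empties_at add1n eqSS. Qed.

Lemma served_pmf_subprob : subprob (fun m => served_pmf a m.+1).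
Proof.
split=> [k|N]; first by rewrite served_pmfE emptying_pmf_ge0.
(* The cutoff [N + 1] dominates every [i + 1] with [i < N]. The time 0 term vanishes because the
   queue starts with one customer. *)
apply: le_trans (sum_emptying_pmf_le1 N.+1 1 N.+1).
rewrite big_ord_recl /= add0r big_mkord; apply: ler_sum => i _.
by rewrite served_pmfE; apply: emptying_pmf_le; rewrite ltnS; exact/ltnW.
Qed.

End FirstPassage.

(** * Convolutions and compound geometric laws *)

Section CompoundGeometric.
Context {R : realType}.
Implicit Types (u v : nat -> R).

(** The pairs with [i + j < N] lie in the square [i, j < N], whose mass is a product of two partial
    sums. *)
Lemma conv_subprob {u v} : subprob u -> subprob v -> subprob (Defs.conv u v).
Proof.
move=> [u0 u1] [v0 v1]; split=> [k|N].
  by apply: sumr_ge0 => i _; rewrite mulr_ge0.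
apply: (@le_trans _ _ ((\sum_(0 <= i < N) u i) * (\sum_(0 <= j < N) v j))); last first.
  by rewrite mulr_ile1// sumr_ge0.
rewrite mulr_suml.
have -> : \sum_(0 <= k < N) Defs.conv u v k =
    \sum_(0 <= i < N) \sum_(0 <= k < N | (i <= k)%N) u i * v (k - i)%N.
  rewrite (exchange_big_dep xpredT)//=; apply: eq_big_nat => k /andP[_ kN].
  rewrite /Defs.conv -(big_mkord xpredT (fun i => u i * v (k - i)%N)).
  rewrite (big_cat_nat (leq0n k.+1) kN)/= [X in _ = _ + X]big_nat_cond.
  rewrite [X in _ = _ + X]big_pred0 ?addr0; last by move=> i; apply/negbTE; lia.
  by rewrite [LHS]big_nat_cond [RHS]big_nat_cond; apply: eq_bigl => i; lia.
apply: ler_sum_nat => i /andP[_ iN].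
rewrite -mulr_sumr ler_wpM2l// (big_cat_nat (leq0n i) (ltnW iN))/=.
rewrite big_nat_cond big_pred0 ?add0r; last by move=> k; apply/negbTE; lia.
(* Shifting [k] by [i] leaves the first [N - i] terms of [v], which are then completed to the first
   [N]. *)
rewrite -{1}(add0n i) big_addn.
rewrite [leRHS](big_cat_nat (leq0n (N - i)%N) (leq_subr i N))/= -[leLHS]addr0 lerD ?sumr_ge0//.
rewrite big_mkcond; apply: ler_sum => k _; case: ifP => _ //.
by rewrite addnK.
Qed.

Lemma convpow_subprob {u} k : subprob u -> subprob (convpow u k).
Proof.
move=> su; elim: k => [|k IH] /=; last exact: conv_subprob.
split=> [k|[|N]]; [by case: ifP|by rewrite big_nil|].
by rewrite big_ltn//= big_nat_cond big1 ?addr0// => -[].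
Qed.

(** A sum of [k] positive integers is 0 only when [k = 0]. *)
Lemma convpow_at0 {u} k : u 0%N = 0 -> convpow u k 0 = (k == 0%N)%:R.
Proof. by case: k => [|k] //= u0; rewrite /Defs.conv big_ord1 u0 mulr0. Qed.

Lemma geometric_subprob (p : R) : 0 <= p <= 1 ->
  subprob (fun k => p * (1 - p) ^+ k).
Proof.
move=> /andP[p0 p1]; split=> [k|N]; first by rewrite mulr_ge0// exprn_ge0// subr_ge0.
suff -> : \sum_(0 <= k < N) p * (1 - p) ^+ k = 1 - (1 - p) ^+ N.
  by rewrite gerBl exprn_ge0// subr_ge0.
elim: N => [|N IH]; first by rewrite big_nil expr0 subrr.
by rewrite big_nat_recr//= IH exprS; ring.
Qed.

Section Law.
Variables (p : R) (u : nat -> R).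
Hypotheses (p01 : 0 <= p <= 1) (su : subprob u).

Let term_ge0 k n : 0 <= p * (1 - p) ^+ k * convpow u k n.
Proof. by rewrite mulr_ge0 ?(geometric_subprob p p01).1// (convpow_subprob k su).1. Qed.

(** Each inner sum is at most its geometric weight. This yields both the finiteness of every atom
    and total mass at most 1. *)
Let sum_terms_le1 N :
  (\sum_(k <oo) (\sum_(0 <= n < N) p * (1 - p) ^+ k * convpow u k n)%:E <= 1%:E)%E.
Proof.
apply: nneseries_le_real => [k|K]; first by apply: sumr_ge0.
apply: le_trans ((geometric_subprob p p01).2 K); apply: ler_sum => k _.
by rewrite -mulr_sumr ler_piMr ?(geometric_subprob p p01).1// (convpow_subprob k su).2.
Qed.

Lemma compound_geom_pmf_fin n :
  (compound_geom_pmf p u n)%:E = (\sum_(k <oo) (p * (1 - p) ^+ k * convpow u k n)%:E)%E.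
Proof.
rewrite /compound_geom_pmf fineK// fin_numElt; apply/andP; split.
  by apply: lt_le_trans (nneseries_ge0 _) => // k _ _; rewrite lee_fin.
apply: (@le_lt_trans _ _ 1%:E); last by rewrite ltry.
apply: le_trans (sum_terms_le1 n.+1).
apply: lee_nneseries => k; first by rewrite lee_fin.
by move=> _; rewrite lee_fin big_nat_recr//= lerDr sumr_ge0.
Qed.

Lemma compound_geom_subprob : subprob (compound_geom_pmf p u).
Proof.
split=> [n|N].
  by apply/fine_ge0/nneseries_ge0 => k _ _; rewrite lee_fin.
rewrite -lee_fin -sumEFin; under eq_bigr do rewrite compound_geom_pmf_fin.
rewrite -nneseries_sum; last by move=> *; rewrite lee_fin.
by under eq_eseriesr do rewrite sumEFin.
Qed.

Lemma compound_geom_pmf0 : u 0%N = 0 -> compound_geom_pmf p u 0 = p.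
Proof.
move=> u0; apply: EFin_inj; rewrite compound_geom_pmf_fin.
rewrite nneseries_recl//; last by move=> k _; rewrite lee_fin.
rewrite convpow_at0// expr0 !mulr1 eseries0 ?adde0// => -[|k] // _ _.
by rewrite convpow_at0// mulr0.
Qed.

End Law.

(** Both entries of the minimum are [p] plus a nonnegative term; [Num.sqrt] is nonnegative at every
    argument, so the sign of [u * ln (1 - p)] does not matter. *)
Lemma Hp_ge (p : R) (q : nat -> R) : 0 <= p <= 1 -> (forall k, 0 <= q k) ->
  p <= Hp p q.
Proof.
move=> /andP[p0 p1] q0; rewrite /Hp /=.
have t1 : p <= p + (1 - p) * prob_in q [set k | (1 < k)%N].
  by rewrite lerDl mulr_ge0 ?subr_ge0// prob_in_ge0.
by case: ifP => // _; rewrite le_min t1/= ler_peMr// lerDl sqrtr_ge0.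
Qed.

End CompoundGeometric.

(** * Jensen's inequality and convexity for the Laplace transform *)

Section Laplace.
Context {R : realType}.
Variable f : R -> R.
Hypotheses (mf : measurable_fun setT f) (f_ge0 : forall t, 0 <= f t)
  (f_neg : forall t, t < 0 -> f t = 0)
  (f_int : (\int[@lebesgue_measure R]_(t in setT) (f t)%:E = 1)%E).
Local Notation mu := (@lebesgue_measure R).

Lemma ge0_integrable {g : R -> R} : measurable_fun setT g -> (forall x, 0 <= g x) ->
  (\int[mu]_(x in setT) (g x)%:E < +oo)%E -> mu.-integrable setT (EFin \o g).
Proof.
move=> mg g0 gfin; apply/integrableP; split; first exact/measurable_EFinP.
by under eq_integral do rewrite /= ger0_norm//.
Qed.

Lemma density_integrable : mu.-integrable setT (EFin \o f).
Proof. by apply: ge0_integrable => //; rewrite f_int ltry. Qed.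

Let measurable_xf : measurable_fun setT (fun x : R => x * f x).
Proof. exact: measurable_funM. Qed.

Let measurable_expRN s : measurable_fun setT (fun x : R => expR (- (s * x))).
Proof.
apply: measurableT_comp; first exact: measurable_expR.
by apply: measurableT_comp => //; apply: measurable_funM.
Qed.

Let measurable_expf s : measurable_fun setT (fun x : R => expR (- (s * x)) * f x).
Proof. exact: measurable_funM. Qed.

Let xf_ge0 x : 0 <= x * f x.
Proof.
by have [x0|/f_neg ->] := leP 0 x; rewrite ?mulr0// mulr_ge0.
Qed.

Let expf_ge0 s x : 0 <= expR (- (s * x)) * f x.
Proof. by rewrite mulr_ge0 ?expR_ge0. Qed.

Lemma laplace_integrable {s} : (laplaceE f s < +oo)%E ->
  mu.-integrable setT (EFin \o (fun x => expR (- (s * x)) * f x)).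
Proof. exact: ge0_integrable. Qed.

Let Rint_f : \int[mu]_(x in setT) f x = 1.
Proof. by rewrite /Rintegral f_int. Qed.

(* Jensen's inequality, by integrating the tangent line of [exp] at the mean. *)
Lemma expR_mean_le_laplace s : (ES f < +oo)%E -> (laplaceE f s < +oo)%E ->
  expR (- (s * fine (ES f))) <= laplace f s.
Proof.
move=> ESfin Ls; set m := fine (ES f); set e := expR _.
have If := density_integrable; have Ixf := ge0_integrable measurable_xf xf_ge0 ESfin.
have I1 := integrableZl measurableT (e * (1 + s * m)) If.
have I2 := integrableZl measurableT (- (e * s)) Ixf.
(* The tangent is expanded into multiples of [f] and [x * f], whose integrals are 1 and [m]. *)
have -> : e = \int[mu]_(x in setT) (e * (1 + s * m) * f x + - (e * s) * (x * f x)).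
  rewrite RintegralD// RintegralZl// RintegralZl// Rint_f.
  by rewrite (_ : Rintegral _ _ _ = m)//; ring.
apply: le_Rintegral => //; first exact: (integrableD measurableT I1 I2).
  exact: laplace_integrable.
move=> x _; rewrite [leLHS](_ : _ = e * (1 + - (s * (x - m))) * f x); last by ring.
rewrite ler_wpM2r// [leRHS](_ : _ = e * expR (- (s * (x - m)))).
  by rewrite ler_wpM2l ?expR_ge0// expR_ge1Dx.
by rewrite -expRD; congr expR; ring.
Qed.

Lemma laplaceE_le1 s : 0 <= s -> (laplaceE f s <= 1)%E.
Proof.
move=> s0; rewrite -f_int; apply: ge0_le_integral => //.
- by move=> x _; rewrite lee_fin.
- by move/measurable_EFinP: (measurable_expf s).
- by move/measurable_EFinP: mf.
- move=> x _; rewrite lee_fin; have [x0|/f_neg ->] := leP 0 x; last by rewrite mulr0.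
  by rewrite ler_piMl// expR_le1 oppr_le0 mulr_ge0.
Qed.

Lemma laplace_le1 s : 0 <= s -> laplace f s <= 1.
Proof.
move=> s0; have := laplaceE_le1 s s0; rewrite /laplace.
by case: (laplaceE f s) => [r||] //=; rewrite lee_fin.
Qed.

(** Convexity on the segment from [s] to 0, where the transform equals 1; it is inherited pointwise
    from [expR]. *)
Lemma laplace_segment0_le {s t} : (laplaceE f s < +oo)%E -> 0 <= t <= 1 ->
  laplace f ((1 - t) * s) <= (1 - t) * laplace f s + t.
Proof.
move=> Ls /andP[t0 t1].
have If := density_integrable; have Is := laplace_integrable Ls.
have I1 := integrableZl measurableT (1 - t) Is.
have I2 := integrableZl measurableT t If.
have I12 := integrableD measurableT I1 I2.
have lep x : expR (- ((1 - t) * s * x)) * f x <=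
    (1 - t) * (expR (- (s * x)) * f x) + t * f x.
  rewrite mulrA -mulrDl ler_wpM2r//.
  set y := - (s * x); set z := - _.
  have zE : z = (1 - t) * y by rewrite /z /y; ring.
  (* The tangent of [expR] at [z] is compared with [expR] at [y] and at 0. With weights [1 - t] and
     [t] the linear terms cancel, since [z = (1 - t) * y]. *)
  have h1 : expR z * (1 + (y - z)) <= expR y.
    by rewrite -[in leRHS](subrKC z y) expRD ler_wpM2l ?expR_ge0 ?expR_ge1Dx.
  have h2 : expR z * (1 - z) <= 1.
    by rewrite -[leRHS](expRxMexpNx_1 z) ler_wpM2l ?expR_ge0 ?expR_ge1Dx.
  have -> : expR z = (1 - t) * (expR z * (1 + (y - z))) + t * (expR z * (1 - z)).
    by rewrite zE; ring.
  by rewrite lerD// ?ler_piMr// ler_wpM2l// subr_ge0.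
have -> : (1 - t) * laplace f s + t =
    \int[mu]_(x in setT) ((1 - t) * (expR (- (s * x)) * f x) + t * f x).
  by rewrite RintegralD// RintegralZl// RintegralZl// Rint_f mulr1.
apply: le_Rintegral => //.
apply: le_integrable I12 => //; first by move/measurable_EFinP: (measurable_expf ((1 - t) * s)).
move=> x _ /=; rewrite lee_fin !ger0_norm ?lep//.
by rewrite addr_ge0// mulr_ge0// subr_ge0.
Qed.

(** Convexity towards 0 bounds the difference quotient at [s] in the direction [- s] by
    [1 - laplace f s]; then let the step tend to 0 from the right. Using the direction [- s] avoids
    a case split on the sign of [s]. *)
Lemma laplace_tangent {s} : (laplaceE f s < +oo)%E -> derivable (laplace f) s 1 ->
  laplace f s - s * derive1 (laplace f) s <= 1.
Proof.
move=> Ls ds; have dif : differentiable (laplace f) s by exact/derivable1_diffP.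
have DE : 'D_(- s) (laplace f) s = - s * derive1 (laplace f) s.
  rewrite derive1E !deriveE//.
  have {1}-> : - s = - s *: (1 : R) by rewrite /GRing.scale/= mulr1.
  by rewrite linearZ.
have dvs : derivable (laplace f) s (- s) by exact: diff_derivable.
rewrite -mulNr -DE -lerBrDl /derive cvg_at_rightE//; apply: limr_le.
  by apply: cvgP; apply: cvg_dnbhs_at_right; exact: dvs.
near=> h.
have h0 : 0 < h by near: h; exact: nbhs_right_gt.
have h1 : h < 1 by near: h; exact: nbhs_right_lt.
rewrite /= /shift/= [_ + s](_ : _ = (1 - h) * s); last by rewrite /GRing.scale/=; ring.
rewrite [leLHS]mulrC ler_pdivrMr// lerBlDr.
have := laplace_segment0_le (t := h) Ls; rewrite (ltW h0) (ltW h1) => /(_ isT).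
by move=> H; apply: le_trans H _; lra.
Unshelve. all: by end_near. Qed.

(** * Poisson arrivals during one service *)

Section Arrivals.
Variable lam : R.
Hypothesis lam_ge0 : 0 <= lam.

Lemma exp_coeff_sum_le (x : R) N : 0 <= x ->
  \sum_(0 <= k < N) x ^+ k / k`!%:R <= expR x.
Proof.
move=> x0; have := @nondecreasing_cvgn_le _ (series (exp_coeff x)) _ (is_cvg_series_exp_coeff x) N.
apply; apply/nondecreasing_seqP => n.
by rewrite /series/= big_nat_recr//= lerDl /exp_coeff/= divr_ge0// exprn_ge0.
Qed.

Let arr k x : R := f x * expR (- (lam * x)) * (lam * x) ^+ k / k`!%:R.

Let arr_ge0 k x : 0 <= arr k x.
Proof.
rewrite /arr; have [x0|/f_neg ->] := leP 0 x; last by rewrite !mul0r.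
by rewrite !mulr_ge0 ?expR_ge0 ?exprn_ge0 ?mulr_ge0// invr_ge0.
Qed.

Let measurable_arr k : measurable_fun setT (fun x => (arr k x)%:E).
Proof.
apply/measurable_EFinP; apply: measurable_funM => //; apply: measurable_funM.
  exact: measurable_funM.
by apply: measurable_funX; exact: measurable_funM.
Qed.

(** Pointwise, the partial exponential sum is at most [expR (lam * x)], which cancels the factor
    [expR (- (lam * x))] and leaves [f x]. *)
Let sum_arr_le N : (\sum_(0 <= k < N) \int[mu]_(x in setT) (arr k x)%:E <= 1)%E.
Proof.
rewrite -ge0_integral_sum//; last by move=> *; rewrite lee_fin.
rewrite -f_int; apply: ge0_le_integral => //.
- by move=> x _; apply: sume_ge0 => k _; rewrite lee_fin.
- exact: emeasurable_sum.
- by move/measurable_EFinP: mf.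
- move=> x _; rewrite sumEFin lee_fin /arr.
  have [x0|/f_neg ->] := leP 0 x; last by rewrite big1// => k _; rewrite !mul0r.
  under eq_bigr do rewrite -mulrA; rewrite -mulr_sumr -mulrA ler_piMr//.
  rewrite -[leRHS](expRxMexpNx_1 (lam * x)) mulrC ler_wpM2r ?expR_ge0//.
  by rewrite exp_coeff_sum_le// mulr_ge0.
Qed.

Lemma arrivals_subprob : subprob (arrivals_pmf f lam).
Proof.
have int_ge0 k : (0 <= \int[mu]_(x in setT) (arr k x)%:E)%E.
  by apply: integral_ge0 => x _; rewrite lee_fin.
have int_fin k : (\int[mu]_(x in setT) (arr k x)%:E)%E \is a fin_num.
  rewrite ge0_fin_numE//; apply: le_lt_trans (ltry 1).
  apply: le_trans (sum_arr_le k.+1); rewrite big_nat_recr//= leeDr//.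
  exact: sume_ge0.
split=> [k|N]; first exact: (fine_ge0 (int_ge0 k)).
rewrite -lee_fin -sumEFin; apply: le_trans (sum_arr_le N).
by apply: lee_sum => k _; rewrite -(fineK (int_fin k)).
Qed.

(** This gives the atom of [W] at 0: only one customer is served exactly when nobody arrives during
    the first service. *)
Lemma arrivals_pmf0 : arrivals_pmf f lam 0 = laplace f lam.
Proof.
rewrite /arrivals_pmf /laplace /laplaceE; congr fine; apply: eq_integral => x _.
by rewrite expr0 fact0 divr1 mulr1 mulrC.
Qed.

End Arrivals.

End Laplace.

(** * Comparison of odds, and the final bound *)

(** Here [d], [F], [mS], [m] stand for [lam - xi], [phi(xi)], [ES], [EX]. Jensen's exponent
    [- xi * mS] is split as [(d * mS - 1) + (1 - rho)], so that [1 + y <= expR y] on each factor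
    gives [F >= d * mS * (2 - rho)] and [d] cancels in [r]. *)
Lemma approximation_gap {R : realType} (lam p rho r d F mS m : R) :
  0 < lam -> 0 < d -> 0 < F -> 0 <= mS -> rho = lam * mS -> rho < 1 ->
  1 - rho <= p -> p <= 1 -> r = lam * F / d -> r <= 1 ->
  expR (d * mS - 1) * expR (1 - rho) <= F ->
  p * r <= (1 - p) * (1 - r) * m ->
  (1 - p) / p <= (1 - p) / p * m - rho / (1 - rho).
Proof.
move=> lam0 d0 F0 mS0 rhoE rho1 p_ge p_le rE r_le F_ge hm.
have rho0 : 0 <= rho by rewrite rhoE mulr_ge0// ltW.
have p0 : 0 < p by lra.
have r0 : 0 < r by rewrite rE divr_gt0// mulr_gt0.
have r_ge : rho * (2 - rho) <= r.
  rewrite rE ler_pdivlMr//.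
  have -> : rho * (2 - rho) * d = lam * (d * mS * (2 - rho)) by rewrite rhoE; ring.
  rewrite ler_pM2l//; apply: le_trans F_ge.
  apply: ler_pM; rewrite ?mulr_ge0 ?(ltW d0)//; first by lra.
    by have := expR_ge1Dx (d * mS - 1); lra.
  by have := expR_ge1Dx (1 - rho); lra.
(* At [r = 1] the hypothesis on [m] would read [p <= 0]. *)
have r1 : r < 1.
  rewrite lt_neqAle r_le andbT; apply/eqP => r1; move: hm.
  by rewrite r1; nra.
(* After clearing denominators this is [2 * rho <= r * (1 + rho)], which follows from [r_ge] and
   [rho <= 1]. *)
have odds_r : 2 * (rho / (1 - rho)) <= r / (1 - r).
  rewrite mulrA ler_pdivrMr ?subr_gt0// mulrAC ler_pdivlMr ?subr_gt0//.
  by nra.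
have odds_p : (1 - p) / p <= rho / (1 - rho).
  rewrite ler_pdivrMr// mulrAC ler_pdivlMr ?subr_gt0//.
  by nra.
have odds_m : r / (1 - r) <= (1 - p) / p * m.
  rewrite ler_pdivrMr ?subr_gt0// -(ler_pM2l p0).
  rewrite [leRHS](_ : _ = (1 - p) * (1 - r) * m)//.
  by field; rewrite gt_eqF.
(* Of the two copies of [rho / (1 - rho)], one absorbs the subtracted term and the other dominates
   [(1 - p) / p]. *)
by lra.
Qed.

Theorem theorem3p2 (R : realType) (lam : R) (f : R -> R) (xi : R) (q : nat -> R)
  (hlam : 0 < lam)
  (hf_meas : measurable_fun setT f)
  (hf_ge0 : forall t : R, 0 <= f t)
  (hf_neg : forall t : R, t < 0 -> f t = 0)
  (hf_int : (\int[@lebesgue_measure R]_(t in setT) (f t)%:E = 1)%E)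
  (hIFR : IFR f)
  (hrho : (lam%:E * ES f < 1)%E)
  (hxi : nearest_laplace_root f lam xi)
  (hq0 : q 0%N = 0)
  (hq_ge0 : forall k : nat, 0 <= q k)
  (hq_sum : (\sum_(k <oo) (q k)%:E = 1)%E) :
  let p := laplace f lam in
  let theta := (xi - lam + lam * laplace f xi) / ((xi - lam) * laplace f lam) in
  let rho := lam * fine (ES f) in
  (((1 - p) * theta)%:E * mean q >= (1 - p * theta)%:E)%E ->
  ((dTV (W_pmf f lam) (compound_geom_pmf p q))%:E
     <= (Hp p q)%:E * (((1 - p) / p)%:E * mean q - (rho / (1 - rho))%:E))%E.
Proof.
move=> p theta rho.
have [[[e e0 fin_near] [der_xi root_xi]] _] := hxi.
have ES_fin : (ES f < +oo)%E.
  rewrite ltey; apply: contraTneq hrho => ->.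
  by rewrite gt0_muley ?lte_fin// -leNgt leey.
have ES_ge0 : (0 <= ES f)%E.
  apply: integral_ge0 => x _; rewrite lee_fin.
  by have [x0|/hf_neg ->] := leP 0 x; rewrite ?mulr0// mulr_ge0.
set mS := fine (ES f) in rho *.
have mS0 : 0 <= mS by exact: fine_ge0.
have rho1 : rho < 1.
  move: hrho; rewrite /rho /mS; move: ES_fin ES_ge0.
  by case: (ES f) => [x||] //= _ _; rewrite -EFinM lte_fin.
have fin_xi : (laplaceE f xi < +oo)%E by apply: fin_near; rewrite subrr normr0.
have fin_lam : (laplaceE f lam < +oo)%E.
  by apply: le_lt_trans (ltry 1); apply: laplaceE_le1 => //; exact: ltW.
have p_le1 : p <= 1 by apply: laplace_le1 => //; exact: ltW.
have p_ge : 1 - rho <= p.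
  apply: le_trans (expR_mean_le_laplace _ _ _ _ _ _ ES_fin fin_lam) => //.
  exact: expR_ge1Dx.
have p0 : 0 < p by lra.
set F := laplace f xi in theta *.
have F_ge : expR (- (xi * mS)) <= F by exact: expR_mean_le_laplace.
have F0 : 0 < F := lt_le_trans (expR_gt0 _) F_ge.
(* Multiply the tangent inequality by [lam] and use [lam * phi'(xi) = -1]. It follows that
   [xi < lam], so [theta] has a nonzero denominator. *)
have tangent : xi + lam * F <= lam.
  have := laplace_tangent _ hf_meas hf_ge0 hf_int fin_xi der_xi.
  rewrite -/F => /(ler_wpM2l (ltW hlam)).
  have lamD : lam * derive1 (laplace f) xi = -1 by lra.
  by rewrite mulrBr mulrCA lamD; lra.
have d0 : 0 < lam - xi by have := mulr_gt0 hlam F0; lra.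
set r := lam * F / (lam - xi).
have pthetaE : 1 - p * theta = r.
  have dN : xi - lam != 0 by rewrite lt_eqF// -opprB oppr_lt0.
  have dP : lam - xi != 0 by rewrite gt_eqF.
  by rewrite /theta /r -/p; field; rewrite ?dN ?dP gt_eqF.
have thetaE : theta = (1 - r) / p by rewrite -pthetaE; field; rewrite gt_eqF.
have r0 : 0 < r by rewrite divr_gt0// mulr_gt0.
have r1 : r <= 1 by rewrite ler_pdivrMr// mul1r; lra.
have p01 : 0 <= p <= 1 by rewrite (ltW p0).
have q_sub : subprob q.
  split=> // N; rewrite -lee_fin -hq_sum -sumEFin.
  by apply: nneseries_lim_ge => n _ _; rewrite lee_fin.
have dTV_le : dTV (W_pmf f lam) (compound_geom_pmf p q) <= 1 - p.
  have W_sub : subprob (W_pmf f lam).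
    by apply/served_pmf_subprob/arrivals_subprob => //; exact: ltW.
  have W0 : W_pmf f lam 0 = p.
    by rewrite /W_pmf served_pmfE /= big_ord1 /= mulr1 arrivals_pmf0.
  rewrite -[in leRHS]W0; apply: dTV_le_tail => //; first exact: compound_geom_subprob.
  by rewrite W0 compound_geom_pmf0.
have H_ge : p <= Hp p q by exact: Hp_ge.
have H0 : 0 < Hp p q := lt_le_trans p0 H_ge.
have mean_ge0 : (0 <= mean q)%E.
  by apply: nneseries_ge0 => n _ _; rewrite lee_fin mulr_ge0.
rewrite pthetaE; move: mean_ge0; case: (mean q) => [m||] // _.
  rewrite -!(EFinM, EFinN, EFinD) !lee_fin => hm.
  have gap : (1 - p) / p <= (1 - p) / p * m - rho / (1 - rho).
    apply: (@approximation_gap _ lam p rho r (lam - xi) F mS) => //.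
      apply: le_trans F_ge; rewrite -expRD ler_expR /rho; lra.
    (* Multiplying the hypothesis by [p] turns [p * theta] into [1 - r]. *)
    have := ler_wpM2l (ltW p0) hm; rewrite thetaE => /le_trans; apply.
    by rewrite le_eqVlt; apply/orP; left; apply/eqP; field; rewrite gt_eqF.
  apply: le_trans dTV_le _; apply: (@le_trans _ _ (p * ((1 - p) / p))).
    by rewrite mulrC divfK// gt_eqF.
  by rewrite ler_pM ?divr_ge0 ?subr_ge0// ltW.
(* Now [mean q] is infinite. If [p = 1], the convention [0 * +oo = 0] turns the hypothesis into
   [r <= 0], a contradiction; otherwise the right-hand side is [+oo]. *)
have [p1|p1] := eqVneq p 1.
  by rewrite p1 subrr mul0r mul0e lee_fin leNgt r0.
have p_lt1 : p < 1 by rewrite lt_neqAle p1.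
move=> _; rewrite gt0_muley; last by rewrite lte_fin divr_gt0// subr_gt0.
by rewrite addye// gt0_muley ?lte_fin// leey.
Qed.
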